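(* Let $1\le k\le N-1$ and let $L$ be a real symmetric positive definite $N\times N$ matrix. For $H\in\mathrm{Sym}(N)$, the score in direction $H$ vanishes for every $A$, i.e. $\mathcal{S}_H(A;L)=0$ for all $A\in\mathcal{X}_k$, if and only if there is a constant $\gamma\in\mathbb{R}$ such that $$\mathrm{tr}(L_A^{-1}H_A)=\gamma\quad\text{for all }A\in\mathcal{X}_k.$$ Further, the linear space of non-identifiable directions satisfies $$\dim\bigl\{H\in\mathrm{Sym}(N):\mathcal{S}_H(A;L)=0\ \text{for all }A\in\mathcal{X}_k\bigr\}\ \ge\ \frac{N(N+1)}{2}-\binom{N}{k}+1.$$ In particular, if $\binom{N}{k}<\frac{N(N+1)}{2}$, then the space of non-identifiable directions has dimension strictly larger than that of the one-dimensional scale cone $\{cL:c>0\}$, i.e. strictly larger than $1$.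
   Context: Let $\mathcal{Y}=\{1,\ldots,N\}$ and $\mathcal{X}_k=\{A\subseteq\mathcal{Y}:|A|=k\}$. $\mathrm{Sym}(N)$ is the real vector space of real symmetric $N\times N$ matrices. For an $N\times N$ matrix $L$ and $A\subseteq\mathcal{Y}$, $L_A$ is the principal submatrix with rows and columns in $A$. Put $Z_k(L)=\sum_{A\in\mathcal{X}_k}\det(L_A)$; for a real symmetric positive semidefinite $L$ with $Z_k(L)>0$ (automatic when $L$ is positive definite), the $k$-DPP with kernel $L$ is the probability measure on $\mathcal{X}_k$ given by $P^k_L(A)=\det(L_A)/Z_k(L)$. For positive definite $L$ and $H\in\mathrm{Sym}(N)$, the log-likelihood score in direction $H$ is $$\mathcal{S}_H(A;L)=\frac{d}{dt}\log P^k_{L+tH}(A)\Big|_{t=0},\qquad A\in\mathcal{X}_k$$ (note $L+tH$ is positive definite for $|t|$ small). *)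

(* Defs.v *)
(* Built on MathComp and MathComp-Analysis. *)
From mathcomp Require Import all_boot all_order all_algebra.
From mathcomp Require Import all_classical all_reals all_analysis.

Set Implicit Arguments.
Unset Strict Implicit.
Unset Printing Implicit Defensive.

Import Order.TTheory GRing.Theory Num.Theory.
Import numFieldNormedType.Exports.

Local Open Scope ring_scope.

(* The ground set {1, ..., N} is represented by 'I_N = {0, ..., N - 1}. *)
Definition ksubsets (N k : nat) : {set {set 'I_N}} :=
  [set A : {set 'I_N} | #|A| == k]%SET.

(* The rows and columns in A are listed in increasing order. *)
Definition principal_submx (R : Type) (N : nat) (L : 'M[R]_N) (A : {set 'I_N})
    : 'M[R]_#|A| :=
  mxsub (fun i : 'I_#|A| => enum_val i) (fun j : 'I_#|A| => enum_val j) L.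

Definition posdefmx (R : numDomainType) (N : nat) (L : 'M[R]_N) : Prop :=
  forall x : 'cV[R]_N, x != 0 -> 0 < (x^T *m L *m x) 0 0.

Definition kdpp_norm (R : comNzRingType) (N k : nat) (L : 'M[R]_N) : R :=
  \sum_(A in ksubsets N k) \det (principal_submx L A).

(* The point masses of the k-DPP with kernel L; meaningful for A in
   [ksubsets N k], the support space of the distribution. *)
Definition kdpp (R : fieldType) (N k : nat) (L : 'M[R]_N) (A : {set 'I_N}) : R :=
  \det (principal_submx L A) / kdpp_norm k L.

(* [ln] and [derive1] are total functions; for L positive definite and H
   symmetric the mass is positive and differentiable in t near 0, so that both
   have their usual meaning. *)
Definition score (R : realType) (N k : nat) (L H : 'M[R]_N) (A : {set 'I_N}) : R :=
  derive1 (fun t : R => ln (kdpp k (L + t *: H) A)) 0.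

Definition score_vanishes (R : realType) (N k : nat) (L H : 'M[R]_N) : Prop :=
  forall A : {set 'I_N}, A \in ksubsets N k -> score k L H A = 0.

(* Main.v *)
(** By Jacobi's formula the derivative of [det (L_A + t H_A)] at 0 is
    [det L_A * tr (L_A^-1 H_A)], so the score at A is [tr (L_A^-1 H_A)] minus
    its mean under the k-DPP; it vanishes for all A iff the trace does not
    depend on A. The non-identifiable directions are thus cut out of all
    N x N matrices by N(N-1)/2 symmetry equations and binom(N,k) - 1 equations
    [tr (L_A^-1 H_A) = tr (L_A0^-1 H_A0)], which bounds their dimension below. *)
Require Import Defs.
From HB Require Import structures.
From mathcomp Require Import all_boot all_order all_algebra.
From mathcomp Require Import all_classical all_reals all_analysis.
From mathcomp Require Import ring lra zify.

Set Implicit Arguments.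
Unset Strict Implicit.
Unset Printing Implicit Defensive.

Import Order.TTheory GRing.Theory Num.Theory.
Import numFieldNormedType.Exports.

Local Open Scope ring_scope.

Lemma deriv_prod_seq (R : comNzRingType) (I : eqType) (r : seq I)
    (F : I -> {poly R}) :
  uniq r ->
  (\prod_(i <- r) F i)^`() =
    \sum_(i <- r) (F i)^`() * \prod_(j <- r | j != i) F j.
Proof.
elim: r => [_|x r IHr /= /andP[xr ur]]; first by rewrite !big_nil derivC.
rewrite !big_cons derivM IHr // eqxx /=; congr (_ * _ + _).
  rewrite [LHS]big_seq_cond [RHS]big_seq_cond; apply: eq_bigl => j.
  by rewrite andbT; case: (boolP (j \in r)) => //= jr; apply/esym/(memPn xr).
rewrite mulr_sumr; apply: eq_big_seq => i ir.
by rewrite big_cons eq_sym (memPn xr) // mulrCA.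
Qed.

(** Jacobi's formula. The Leibniz rule differentiates one row at a time, giving the matrices [B i];
    expanding [\det (B i)] along row i meets only cofactors of [A], since these omit the
    differentiated row. *)
Lemma deriv_det (R : comNzRingType) (n : nat) (A : 'M[{poly R}]_n) :
  (\det A)^`() = \tr (\adj A *m map_mx (@deriv R) A).
Proof.
pose B i := \matrix_(p, q) if p == i then (A p q)^`() else A p q.
have -> : \tr (\adj A *m map_mx (@deriv R) A) = \sum_i \det (B i).
  rewrite mxtrace_mulC; apply: eq_bigr => i _.
  rewrite mxE (expand_det_row (B i) i); apply: eq_bigr => j _.
  rewrite !mxE eqxx; congr (_ * (_ * \det _)).
  by apply/matrixP => p q; rewrite !mxE eq_sym (negPf (neq_lift _ _)).
rewrite /determinant exchange_big raddf_sum /=; apply: eq_bigr => s _.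
rewrite raddfMsign /= -mulr_sumr.
congr (_ * _); rewrite deriv_prod_seq ?index_enum_uniq //.
apply: eq_bigr => i _; rewrite [RHS](bigD1 i) //= mxE eqxx; congr (_ * _).
by apply: eq_bigr => j /negPf ji; rewrite mxE ji.
Qed.

(** Kept as a polynomial in the parameter, so that it can be differentiated formally and is open to
    the intermediate value theorem for polynomials. *)
Definition detpencil (R : comNzRingType) (n : nat) (A B : 'M[R]_n) : {poly R} :=
  \det (map_mx polyC A + 'X *: map_mx polyC B).

Lemma horner_detpencil (R : comNzRingType) (n : nat) (A B : 'M[R]_n) (t : R) :
  (detpencil A B).[t] = \det (A + t *: B).
Proof.
rewrite -horner_evalE -det_map_mx; congr (\det _).
by apply/matrixP => i j; rewrite !mxE /= /horner_eval !hornerE.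
Qed.

Lemma deriv_detpencil0 (R : fieldType) (n : nat) (A B : 'M[R]_n) :
  A \in unitmx -> (detpencil A B)^`().[0] = \det A * \tr (invmx A *m B).
Proof.
move=> Au; rewrite deriv_det -horner_evalE -trace_map_mx map_mxM map_mx_adj.
rewrite -mxtraceZ scalemxAl /invmx Au scalerA mulfV -?unitfE -?unitmxE //.
rewrite scale1r; congr (\tr (\adj _ *m _)); apply/matrixP => i j.
  by rewrite !mxE /= /horner_eval !hornerE.
by rewrite !mxE /= /horner_eval derivD derivM derivX !derivC !hornerE.
Qed.

Lemma posdefmx_det_gt0 (R : rcfType) (n : nat) (A : 'M[R]_n) :
  posdefmx A -> 0 < \det A.
Proof.
(* Otherwise, by the intermediate value theorem, some convex combination of
   A and the identity would be singular, but it is positive definite. *)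
move=> Apos; rewrite ltNge; apply/negP => detA.
have: (detpencil A (1%:M - A)).[0] <= 0 <= (detpencil A (1%:M - A)).[1].
  rewrite !horner_detpencil scale0r scale1r addr0 detA addrC subrK det1.
  exact: ler01.
case/(poly_ivt ler01) => x /andP[x0 x1].
rewrite rootE horner_detpencil => /det0P[v v0 /(congr1 (mulmx^~ v^T))].
move/(congr1 (fun M : 'M[R]_1 => M 0 0)).
have vT0 : v^T != 0 by rewrite -trmx0 (inj_eq trmx_inj).
have := Apos _ vT0; rewrite trmxK.
have : 0 < (v *m v^T) 0 0.
  rewrite mxE lt0r sumr_ge0 ?andbT; last by move=> i _; rewrite mxE sqr_ge0.
  rewrite psumr_eq0; last by move=> i _; rewrite mxE sqr_ge0.
  apply: contra v0 => /allP v0; apply/eqP/rowP => i.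
  have := v0 i (mem_index_enum _).
  by rewrite !mxE mulf_eq0 orbb => /eqP.
(* The null vector [v] gives (1 - x) b + x a = 0 with a, b > 0 and 0 <= x <= 1, which is
   impossible. *)
rewrite mulmxDr -scalemxAr mulmxBr mulmx1 !mulmxDl -scalemxAl mulmxBl mul0mx.
set a := v *m v^T; set b := v *m A *m v^T; rewrite !mxE.
by nra.
Qed.

(** The submatrix is the congruence [E^T *m L *m E] by the coordinate embedding [E], and [E] kills
    no nonzero vector because injectivity of [f] makes [E^T] a left inverse. *)
Lemma posdefmx_mxsub (R : numDomainType) (m n : nat) (f : 'I_m -> 'I_n)
    (L : 'M[R]_n) :
  injective f -> posdefmx L -> posdefmx (mxsub f f L).
Proof.
move=> f_inj Lpos x x0; pose E : 'M[R]_(n, m) := colsub f 1%:M.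
have ETE : E^T *m E = 1%:M.
  rewrite /E trmx_mxsub trmx1 -mxsub_mul mulmx1.
  by apply/matrixP => i j; rewrite !mxE (inj_eq f_inj).
have Ex0 : E *m x != 0.
  by apply: contra x0 => /eqP Ex0; rewrite -[x]mul1mx -ETE -mulmxA Ex0 mulmx0.
have -> : mxsub f f L = E^T *m L *m E.
  by rewrite /E trmx_mxsub trmx1 mul_rowsub_mx mul1mx -mxsub_mul mulmx1.
by have := Lpos _ Ex0; rewrite trmx_mul !mulmxA.
Qed.

Section Score.
Variables (R : realType) (N k : nat) (L : 'M[R]_N).
Hypotheses (kN : (k <= N)%N) (posL : posdefmx L).

(** The logarithmic derivative at t = 0 of the principal minor of [L + t *: H] on [A]. *)
Let tilt H A := \tr (invmx (principal_submx L A) *m principal_submx H A).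

Lemma det_principal_gt0 A : 0 < \det (principal_submx L A).
Proof. exact/posdefmx_det_gt0/posdefmx_mxsub/posL/enum_val_inj. Qed.

Lemma card_ksubsets : #|ksubsets N k| = 'C(N, k).
Proof. by rewrite card_draws card_ord. Qed.

Lemma kdpp_norm_gt0 : 0 < kdpp_norm k L.
Proof.
have [A Ak] : exists A, A \in ksubsets N k.
  by apply/card_gt0P; rewrite card_ksubsets bin_gt0.
rewrite /kdpp_norm (bigD1 A) //=; apply: ltr_wpDr (det_principal_gt0 A).
by apply: sumr_ge0 => B _; apply/ltW/det_principal_gt0.
Qed.

Lemma score_posdef H A :
  score k L H A = tilt H A - \sum_(B in ksubsets N k) kdpp k L B * tilt H B.
Proof.
pose P B := detpencil (principal_submx L B) (principal_submx H B).
pose Q := \sum_(B in ksubsets N k) P B.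
have PE t B : \det (principal_submx (L + t *: H) B) = (P B).[t].
  rewrite horner_detpencil; congr (\det _).
  by apply/matrixP => i j; rewrite !mxE.
have L0 : L = L + 0 *: H by rewrite scale0r addr0.
have P0 B : (P B).[0] = \det (principal_submx L B) by rewrite -PE -L0.
have QE t : kdpp_norm k (L + t *: H) = Q.[t].
  by rewrite horner_sum; apply: eq_bigr => B _; rewrite PE.
have Q0 : Q.[0] = kdpp_norm k L by rewrite -QE -L0.
have Z0 := kdpp_norm_gt0; have D0 := det_principal_gt0 A.
have dP B : (P B)^`().[0] = \det (principal_submx L B) * tilt H B.
  by rewrite deriv_detpencil0 // unitmxE unitfE gt_eqF // det_principal_gt0.
have dQ : Q^`().[0] =
    \sum_(B in ksubsets N k) \det (principal_submx L B) * tilt H B.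
  by rewrite raddf_sum horner_sum; apply: eq_bigr => B _; rewrite dP.
have Qn0 : Q.[0] != 0 by rewrite Q0 gt_eqF.
(* The point mass at [A] as a rational function of t. The chain rule for [ln] only asks that [Q] be
   nonzero and [q] positive at 0 itself. *)
pose q : R -> R := horner (P A) * (fun t => (Q.[t])^-1).
have qE : q 0 = \det (principal_submx L A) / kdpp_norm k L by rewrite -P0 -Q0.
have q0 : 0 < q 0 by rewrite qE divr_gt0.
have der_q : is_derive (0 : R) (1 : R) q _ := is_deriveM
  (is_derive_poly (P A) 0) (is_deriveV Qn0 (is_derive_poly Q 0)).
have der := is_derive1_comp (is_derive1_ln q0) der_q.
rewrite /score derive1E.
have -> : (fun t => ln (kdpp k (L + t *: H) A)) =
    @ln R \o q.
  by apply/funext => t /=; rewrite /kdpp PE QE.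
rewrite (derive_val (is_derive := der)) qE P0 Q0 dP dQ.
have -> : \sum_(B in ksubsets N k) kdpp k L B * tilt H B =
    (\sum_(B in ksubsets N k) \det (principal_submx L B) * tilt H B) /
      kdpp_norm k L.
  by rewrite mulr_suml; apply: eq_bigr => B _; rewrite /kdpp mulrAC.
rewrite /GRing.scale /=; field.
by rewrite !gt_eqF.
Qed.

Lemma sum_kdpp : \sum_(A in ksubsets N k) kdpp k L A = 1.
Proof. by rewrite -mulr_suml divff // gt_eqF // kdpp_norm_gt0. Qed.

(** If all scores vanish, the constant is the k-DPP mean of the traces; conversely a constant equals
    its own mean, as the masses sum to 1. *)
Lemma score_vanishesP H :
  score_vanishes k L H <->
  exists gamma, forall A, A \in ksubsets N k -> tilt H A = gamma.
Proof.
split=> [sc0|[gamma tilt_cst] A Ak].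
  exists (\sum_(B in ksubsets N k) kdpp k L B * tilt H B) => A Ak.
  by apply/eqP; rewrite -subr_eq0 -score_posdef sc0.
rewrite score_posdef tilt_cst //.
rewrite (eq_bigr (fun B => kdpp k L B * gamma)) => [|B Bk].
  by rewrite -mulr_suml sum_kdpp mul1r subrr.
by rewrite tilt_cst.
Qed.

End Score.

(** Rank-nullity for the map to row vectors whose coordinates are the forms indexed by [S]: its
    image has dimension at most [#|S|]. *)
Lemma common_kernel (K : fieldType) (vT : vectType K) (I : finType)
    (S : {set I}) (f : I -> vT -> K) :
  (forall i, scalar (f i)) ->
  exists V : {vspace vT},
    (forall v, v \in V <-> forall i, i \in S -> f i v = 0) /\
    (\dim {:vT} <= \dim V + #|S|)%N.
Proof.
move=> f_lin; pose g v : 'rV[K]_#|S| := \row_j f (enum_val j) v.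
have g_lin : linear g by move=> a u v; apply/rowP => j; rewrite !mxE f_lin.
pose gL : {linear vT -> 'rV[K]_#|S|} :=
  HB.pack g (GRing.isLinear.Build K vT 'rV[K]_#|S| *:%R g g_lin).
exists (lker (linfun gL)); split.
  move=> v; rewrite memv_ker lfunE /=; split=> [/eqP gv0 i iS|fv0].
    have := congr1 (fun w : 'rV[K]_#|S| => w 0 (enum_rank_in iS i)) gv0.
    by rewrite !mxE enum_rankK_in.
  by apply/eqP/rowP => j; rewrite !mxE fv0 // enum_valP.
rewrite -(limg_ker_dim (linfun gL) {:vT}) capfv leq_add2l.
apply: leq_trans (dimvS (subvf _)) _.
by rewrite dimvf /dim /= mul1n.
Qed.

(** This counts the symmetry equations; grouping pairs by their larger index j leaves j choices for
    the smaller one. *)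
Lemma card_lt_pairs (N : nat) :
  (\sum_(p : 'I_N * 'I_N | (p.1 < p.2)%N) 1 = 'C(N, 2))%N.
Proof.
rewrite -bin2_sum big_mkord.
rewrite -(pair_big_dep xpredT (fun i j : 'I_N => i < j)%N (fun _ _ => 1%N)) /=.
rewrite (exchange_big_dep xpredT) //=; apply: eq_bigr => j _.
by rewrite (big_ord_narrow (ltnW (ltn_ord j))) sum1_card card_ord.
Qed.

Theorem theorem2 (R : realType) (N k : nat) (hk : (1 <= k <= N - 1)%N)
    (L : 'M[R]_N) (symL : L \is symmetricmx) (posL : posdefmx L) :
  (forall H : 'M[R]_N, H \is symmetricmx ->
     (score_vanishes k L H <->
      exists gamma : R, forall A : {set 'I_N}, A \in ksubsets N k ->
        \tr (invmx (principal_submx L A) *m principal_submx H A) = gamma))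
  /\
  (exists V : {vspace 'M[R]_N},
     [/\ forall H : 'M[R]_N,
           H \in V <-> (H \is symmetricmx /\ score_vanishes k L H),
         ((N * (N + 1)) %/ 2)%N%:Z - 'C(N, k)%:Z + 1 <= (\dim V)%:Z
       & ('C(N, k) < (N * (N + 1)) %/ 2)%N ->
           \dim <[L]>%VS = 1%N /\ (1 < \dim V)%N]).
Proof.
have kN : (k <= N)%N by lia.
split=> [H _|]; first exact: score_vanishesP.
have [A0 A0k] : exists A, A \in ksubsets N k.
  by apply/card_gt0P; rewrite card_ksubsets bin_gt0.
pose tilt A H := \tr (invmx (principal_submx L A) *m principal_submx H A).
pose f (x : 'I_N * 'I_N + {set 'I_N}) (H : 'M[R]_N) :=
  match x with
  | inl p => H p.1 p.2 - H p.2 p.1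
  | inr A => tilt A H - tilt A0 H
  end.
have tilt_lin A : scalar (tilt A).
  by move=> a H1 H2; rewrite /tilt /principal_submx !linearD /= !linearZ.
have f_lin x : scalar (f x).
  by case: x => [p|A] a H1 H2; rewrite /f ?tilt_lin ?mxE; ring.
(* Each symmetry equation is taken once, and the trivial equation at [A0] is dropped; the latter
   yields the + 1 in the bound. *)
pose S := [set x : 'I_N * 'I_N + {set 'I_N} |
  match x with
  | inl p => (p.1 < p.2)%N
  | inr A => A \in ksubsets N k :\ A0
  end].
have cardS : #|S| = ('C(N, 2) + 'C(N, k).-1)%N.
  rewrite -sum1_card (eq_bigl _ _ (finset.in_set _)) big_sumType /= card_lt_pairs.
  by rewrite sum1_card -(card_ksubsets N k) (cardsD1 A0 (ksubsets N k)) A0k.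
have [V [memV dimV]] := common_kernel S f_lin.
(* From N^2 - N(N-1)/2 = N(N+1)/2; the additive form avoids truncated subtraction in [nat]. *)
have le_dim : ((N * (N + 1)) %/ 2 + 1 <= \dim V + 'C(N, k))%N.
  have C0 : (0 < 'C(N, k))%N by rewrite bin_gt0.
  have : ('C(N, 2) * 2 = N * (N - 1))%N.
    by rewrite (bin_ffact N 2) ffactnS ffactn1 subn1.
  move: dimV; rewrite cardS dimvf /dim /=; nia.
move: ((N * (N + 1)) %/ 2)%N le_dim => M le_dim; exists V; split.
- move=> H; rewrite memV score_vanishesP //; split.
    move=> f0; split.
      apply/is_hermitianmxP; rewrite expr0 scale1r; apply/matrixP => i j.
      rewrite !mxE; case: (ltngtP i j) => [ij|ji|/val_inj -> //].
        by apply/subr0_eq/(f0 (inl (i, j))); rewrite inE.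
      by apply/esym/subr0_eq/(f0 (inl (j, i))); rewrite inE.
    exists (tilt A0 H) => A Ak; have [->//|AA0] := eqVneq A A0.
    by apply/subr0_eq/(f0 (inr A)); rewrite inE in_setD1 AA0.
  case=> /is_hermitianmxP; rewrite expr0 scale1r => symH [gamma tilt_cst].
  case=> [p _|A]; rewrite /f.
    by rewrite {1}symH !mxE subrr.
  by rewrite inE in_setD1 => /andP[_ Ak]; rewrite /tilt !tilt_cst ?subrr.
- by move: (\dim V) le_dim => d; lia.
- move=> lt_dim; split; last by move: (\dim V) le_dim => d; lia.
  (* The bounds on k force N >= 2, so a basis vector exists; the quadratic form of [L] is positive
     there, hence [L] is nonzero and spans a line. *)
  have i0 : 'I_N by apply: (@Ordinal N 0); lia.
  rewrite dim_vline; case: eqVneq => // L0.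
  have d0 : delta_mx i0 0 != 0 :> 'cV[R]_N.
    apply/eqP => /matrixP/(_ i0 0); rewrite !mxE !eqxx.
    by move/eqP; rewrite oner_eq0.
  by have := posL _ d0; rewrite L0 mulmx0 mul0mx mxE ltxx.
Qed.
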